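(* For every valid date $D$, every integer $n$ and every value $v$ such that $D+_m n\to^* v$, we have $$\mathrm{nb\_days}(\mathrm{year\_of}(v),\mathrm{month\_of}(v))<\mathrm{day\_of}(v)\iff \mathrm{rnd}_\bot(v)\to^*\bot.$$
   Context: Values (dates). A value is either the error element $\bot$ or a triple $(y,m,d)$ of integers (year, month, day; January is month $1$); triples need not denote an existing day. ''Date'' means such a value. For $v=(y,m,d)$, $\mathrm{year\_of}(v)=y$, $\mathrm{month\_of}(v)=m$, $\mathrm{day\_of}(v)=d$. For an integer $y$ and $1\le m\le 12$, $\mathrm{nb\_days}(y,m)$ is the number of days of month $m$ of year $y$ in the Gregorian calendar: 31 for $m\in\{1,3,5,7,8,10,12\}$, 30 for $m\in\{4,6,9,11\}$, and for $m=2$: 29 if $y$ is leap, else 28, where $y$ is leap iff ($4\mid y$ and $100\nmid y$) or $400\mid y$. A date is valid if it is a triple $(y,m,d)$ with $1\le m\le 12$ and $1\le d\le\mathrm{nb\_days}(y,m)$. Expressions are built from values, month additions $e+_m n$ ($n\in\mathbb Z$) and strict rounding $\mathrm{rnd}_\bot e$. The small-step relation $\to$ is given by the following rules, and $\to^*$ is its reflexive-transitive closure. Error rules: $\bot+_m n\to\bot$; $\mathrm{rnd}_\bot\bot\to\bot$; if $m\notin[1,12]$ then $(y,m,d)+_m n\to\bot$ and $\mathrm{rnd}_\bot(y,m,d)\to\bot$. The following rules assume $1\le m\le 12$. Months: if $1\le m+n\le 12$, $(y,m,d)+_m n\to(y,m+n,d)$; if $m+n<1$, $(y,m,d)+_m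 n\to(y-1,m,d)+_m(n+12)$; if $m+n>12$, $(y,m,d)+_m n\to(y+1,m,d)+_m(n-12)$. Strict rounding: if $d<1$ or $d>\mathrm{nb\_days}(y,m)$, $\mathrm{rnd}_\bot(y,m,d)\to\bot$; if $1\le d\le\mathrm{nb\_days}(y,m)$, $\mathrm{rnd}_\bot(y,m,d)\to(y,m,d)$. *)

(* Defs.v *)
(* Stdlib world: dates are triples over Z. *)
From Stdlib Require Import ZArith Znumtheory Lia Bool Relations.
Open Scope Z_scope.

Inductive value : Type :=
| Bot : value
| Triple (y m d : Z) : value.

(* The projections are partial in the source; on [Bot] they return the
   conventional value 0. *)
Definition year_of (v : value) : Z :=
  match v with Triple y _ _ => y | Bot => 0 end.
Definition month_of (v : value) : Z :=
  match v with Triple _ m _ => m | Bot => 0 end.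
Definition day_of (v : value) : Z :=
  match v with Triple _ _ d => d | Bot => 0 end.

Definition is_leap (y : Z) : bool :=
  ((y mod 4 =? 0) && negb (y mod 100 =? 0)) || (y mod 400 =? 0).

Lemma is_leap_spec (y : Z) :
  is_leap y = true <-> ((4 | y) /\ ~ (100 | y)) \/ (400 | y).
Proof.
  unfold is_leap.
  rewrite orb_true_iff, andb_true_iff, negb_true_iff, Z.eqb_neq, !Z.eqb_eq.
  rewrite !Z.mod_divide by lia. tauto.
Qed.

(* Meaningful only for 1 <= m <= 12; conventionally 0 elsewhere. *)
Definition nb_days (y m : Z) : Z :=
  match m with
  | 1 | 3 | 5 | 7 | 8 | 10 | 12 => 31
  | 4 | 6 | 9 | 11 => 30
  | 2 => if is_leap y then 29 else 28
  | _ => 0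
  end.

Definition valid (v : value) : Prop :=
  match v with
  | Bot => False
  | Triple y m d => 1 <= m <= 12 /\ 1 <= d <= nb_days y m
  end.

Inductive expr : Type :=
| Val (v : value) : expr
| AddM (e : expr) (n : Z) : expr
| RndBot (e : expr) : expr.

(* All redexes have a value as operand: there are no congruence rules. *)
Inductive step : expr -> expr -> Prop :=
| step_add_bot (n : Z) :
    step (AddM (Val Bot) n) (Val Bot)
| step_rnd_bot :
    step (RndBot (Val Bot)) (Val Bot)
| step_add_bad_month (y m d n : Z) :
    ~ (1 <= m <= 12) ->
    step (AddM (Val (Triple y m d)) n) (Val Bot)
| step_rnd_bad_month (y m d : Z) :
    ~ (1 <= m <= 12) ->
    step (RndBot (Val (Triple y m d))) (Val Bot)
| step_add_in (y m d n : Z) :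
    1 <= m <= 12 -> 1 <= m + n <= 12 ->
    step (AddM (Val (Triple y m d)) n) (Val (Triple y (m + n) d))
| step_add_below (y m d n : Z) :
    1 <= m <= 12 -> m + n < 1 ->
    step (AddM (Val (Triple y m d)) n)
         (AddM (Val (Triple (y - 1) m d)) (n + 12))
| step_add_above (y m d n : Z) :
    1 <= m <= 12 -> m + n > 12 ->
    step (AddM (Val (Triple y m d)) n)
         (AddM (Val (Triple (y + 1) m d)) (n - 12))
| step_rnd_invalid_day (y m d : Z) :
    1 <= m <= 12 -> d < 1 \/ d > nb_days y m ->
    step (RndBot (Val (Triple y m d))) (Val Bot)
| step_rnd_valid_day (y m d : Z) :
    1 <= m <= 12 -> 1 <= d <= nb_days y m ->
    step (RndBot (Val (Triple y m d))) (Val (Triple y m d)).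

Definition steps : expr -> expr -> Prop := clos_refl_trans expr step.

(* Main.v *)
(* Month addition from a valid date keeps the month in [1, 12] and never changes
   the day, so the day of [v] is at least 1 and rounding can only fail because
   the day is too large. *)
Require Import Defs.
From Stdlib Require Import ZArith Lia Relations.
Open Scope Z_scope.

(** [month_ok d] is an invariant of reduction: the month stays in range and the day stays [d], also
    in the intermediate [AddM] states. It excludes [Bot], so [v] is a triple with the day of [D],
    and [steps_rnd_bot] says when rounding it fails. *)

Definition month_ok (d : Z) (e : expr) : Prop :=
  match e with
  | Val (Triple _ m d') | AddM (Val (Triple _ m d')) _ => 1 <= m <= 12 /\ d' = d
  | _ => False
  end.

Lemma step_month_ok (d : Z) (e e' : expr) :
  step e e' -> month_ok d e -> month_ok d e'.
Proof. intros H; destruct H; simpl; intuition lia. Qed.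

Lemma steps_month_ok (d : Z) (e e' : expr) :
  steps e e' -> month_ok d e -> month_ok d e'.
Proof. intros H; induction H; eauto using step_month_ok. Qed.

Lemma steps_val (v : value) (e : expr) : steps (Val v) e -> e = Val v.
Proof.
  intros H; apply clos_rt_rt1n in H.
  inversion H as [|e1 e2 Hs]; [reflexivity | inversion Hs].
Qed.

Lemma steps_rnd_bot (y m d : Z) : 1 <= m <= 12 ->
  steps (RndBot (Val (Triple y m d))) (Val Bot) <-> d < 1 \/ nb_days y m < d.
Proof.
  intros Hm; split.
  - intros H; apply clos_rt_rt1n in H.
    inversion H as [|e1 e2 Hs Hrest]; subst.
    inversion Hs; subst; try lia.
    (* A valid day rounds to a triple, which is irreducible and so never reaches [Bot]. *)
    apply clos_rt1n_rt, steps_val in Hrest; discriminate.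
  - intros Hd; apply rt_step, step_rnd_invalid_day; lia.
Qed.

Theorem theorem5 (D : value) (n : Z) (v : value)
  (hD : valid D) (hv : steps (AddM (Val D) n) (Val v)) :
  nb_days (year_of v) (month_of v) < day_of v
  <-> steps (RndBot (Val v)) (Val Bot).
Proof.
  destruct D as [|y m d]; [contradiction|].
  destruct hD as [Hm Hd].
  assert (Hok : month_ok d (Val v))
    by (apply (steps_month_ok _ _ _ hv); simpl; auto).
  destruct v as [|y' m' d']; [contradiction|].
  destruct Hok as [Hm' ->]; simpl.
  (* Validity of [D] gives [1 <= d], which rules out the disjunct [d < 1]. *)
  rewrite steps_rnd_bot by exact Hm'; lia.
Qed.
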